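(* Fix $H$ and $\Lambda$. There are positive constants $c_1,c_2,c_3,c_4$ (depending only on $H$ and $\Lambda$) such that for every $d\ge 1$, every $N$ and every $d$-regular bipartite graph $G$ on $N$ vertices, the following two statements hold, where $f$ denotes a random element of ${\rm Hom}(G,H)$ chosen according to $p_\Lambda$. (1) For every $\varepsilon \geq c_1/\sqrt{d}$ and every $k \in V(H)$, $$p_\Lambda\left(s(k,f) \in I_k(\varepsilon)\right) \leq c_2\varepsilon^{-1}2^{-c_3\varepsilon^2N}.$$ (2) For every $k \in V(H)$, $$\bar{p}_\Lambda(k) \in \left[a_\Lambda^-(k) - c_4\zeta,\; a_\Lambda^+(k) + c_4\zeta\right],\qquad \text{where } \zeta = \max\left\{\frac{1}{\sqrt{d}},\sqrt{\frac{\log N}{N}}\right\}.$$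
   Context: $G=(V(G),E(G))$ is a simple, loopless, finite graph; $H$ is a finite graph without multiple edges but perhaps with loops, having at least one edge (possibly a loop); $\Lambda=\{\lambda_i : i\in V(H)\}$ is a set of positive real weights indexed by the vertices of $H$. Logarithms are to base 2. An $H$-colouring of $G$ is a function $f:V(G)\to V(H)$ such that $uv\in E(G)$ implies $f(u)f(v)\in E(H)$; ${\rm Hom}(G,H)$ is the set of these. Put $w_\Lambda(f)=\prod_{v\in V(G)}\lambda_{f(v)}$, $Z_\Lambda(G,H)=\sum_{f\in{\rm Hom}(G,H)}w_\Lambda(f)$, and let $p_\Lambda$ be the probability distribution on ${\rm Hom}(G,H)$ with $p_\Lambda(f)=w_\Lambda(f)/Z_\Lambda(G,H)$. For $f \in {\rm Hom}(G,H)$ and $k\in V(H)$ let $s(k,f)=|f^{-1}(k)|/|V(G)|$ and let $\bar p_\Lambda(k)=\frac{1}{|V(G)|}\sum_{v\in V(G)}p_\Lambda(f(v)=k)$, the expectation of $s(k,f)$ under $p_\Lambda$. For $A,B\subseteq V(H)$ write $A\sim B$ if $uv\in E(H)$ for all $u\in A$, $v\in B$. Let $w_\Lambda(A)=\sum_{i\in A}\lambda_i$, $\eta_\Lambda(H)=\max\{w_\Lambda(A)w_\Lambda(B):A\sim B\}$, and $\mathcal{M}_\Lambda(H)=\{(A,B): A,B\subseteq V(H),\ A\sim B,\ w_\Lambda(A)w_\Lambda(B)=\eta_\Lambda(H)\}$. For $k\in V(H)$ let $$a_\Lambda^+(k)=\frac{\max\{w_\Lambda(A)\lambda_k\mathbf{1}_{\{k\in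 B\}}+w_\Lambda(B)\lambda_k\mathbf{1}_{\{k\in A\}}:(A,B)\in\mathcal{M}_\Lambda(H)\}}{2\eta_\Lambda(H)},$$ and let $a_\Lambda^-(k)$ be defined in the same way with $\max$ replaced by $\min$. For $\varepsilon>0$ let $I_k(\varepsilon)=[0,a_\Lambda^-(k)-\varepsilon)\cup(a_\Lambda^+(k)+\varepsilon,1]$ (an interval whose endpoints are out of order is empty). *)

(* Defs.v *)
(* MathComp, with the real numbers, real powers and logarithms of
   MathComp-Analysis. *)
From HB Require Import structures.
From mathcomp Require Import all_boot all_order all_algebra.
From mathcomp Require Import reals exp.

Set Implicit Arguments.
Unset Strict Implicit.
Unset Printing Implicit Defensive.

Import Order.TTheory GRing.Theory Num.Theory.
Local Open Scope ring_scope.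

Definition log2 (R : realType) (x : R) : R := ln x / ln 2.

Section Extrema.
Variables (R : realType) (I : finType).
Implicit Types (P : {set I}) (F : I -> R).

(* The value 0 on the empty set is junk: both operators are only used on
   nonempty sets (see compat_pairs_neq0 and optimal_pairs_neq0). *)
Definition maxover P F : R :=
  if [pick i in P] is Some i0 then F [arg max_(i > i0 in P) F i]%O else 0.

Definition minover P F : R :=
  if [pick i in P] is Some i0 then F [arg min_(i < i0 in P) F i]%O else 0.

Lemma maxoverP P F : P != set0 ->
  exists2 i, i \in P & maxover P F = F i /\ forall j, j \in P -> F j <= F i.
Proof.
case/set0Pn=> i iP; rewrite /maxover; case: pickP => [i0 i0P|/(_ i)]; last first.
  by rewrite iP.
by case: arg_maxP => // m mP mmax; exists m.
Qed.

Lemma minoverP P F : P != set0 ->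
  exists2 i, i \in P & minover P F = F i /\ forall j, j \in P -> F i <= F j.
Proof.
case/set0Pn=> i iP; rewrite /minover; case: pickP => [i0 i0P|/(_ i)]; last first.
  by rewrite iP.
by case: arg_minP => // m mP mmin; exists m.
Qed.

End Extrema.

(* A finite graph is a symmetric relation on a finite type; it is loopless when
   the relation is irreflexive. *)

Section Graphs.
Variables (VG : finType) (eG : rel VG).

Definition regular (d : nat) : Prop := forall v, #|[set u | eG v u]| = d.

Definition bipartite : Prop :=
  exists X : {set VG}, forall u v, eG u v -> (u \in X) != (v \in X).

End Graphs.

Section Target.
Variables (R : realType) (VH : finType) (eH : rel VH) (lam : VH -> R).

Definition compat (A B : {set VH}) : bool :=
  [forall u in A, forall v in B, eH u v].

Definition wset (A : {set VH}) : R := \sum_(i in A) lam i.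

Definition compat_pairs : {set {set VH} * {set VH}} :=
  [set AB | compat AB.1 AB.2].

Definition eta : R := maxover compat_pairs (fun AB => wset AB.1 * wset AB.2).

Definition optimal_pairs : {set {set VH} * {set VH}} :=
  [set AB | compat AB.1 AB.2 & wset AB.1 * wset AB.2 == eta].

Lemma compat_pairs_neq0 : compat_pairs != set0.
Proof.
by apply/set0Pn; exists (set0, set0); rewrite inE; apply/forall_inP => u; rewrite inE.
Qed.

Lemma optimal_pairs_neq0 : optimal_pairs != set0.
Proof.
have [AB ABc [eAB _]] :=
  maxoverP (fun AB => wset AB.1 * wset AB.2) compat_pairs_neq0.
by apply/set0Pn; exists AB; move: ABc; rewrite !inE => ->; rewrite /eta eAB eqxx.
Qed.

Definition kweight (k : VH) (AB : {set VH} * {set VH}) : R :=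
  wset AB.1 * lam k * (k \in AB.2)%:R + wset AB.2 * lam k * (k \in AB.1)%:R.

Definition aplus (k : VH) : R := maxover optimal_pairs (kweight k) / (2 * eta).

Definition aminus (k : VH) : R := minover optimal_pairs (kweight k) / (2 * eta).

Definition Ik (k : VH) (eps : R) : pred R :=
  [pred x | (x \in `[0, aminus k - eps[) || (x \in `]aplus k + eps, 1])].

End Target.

Section Colourings.
Variables (R : realType) (VH : finType) (eH : rel VH) (lam : VH -> R).
Variables (VG : finType) (eG : rel VG).

Definition Hom : {set {ffun VG -> VH}} :=
  [set f : {ffun VG -> VH} | [forall u, forall v, eG u v ==> eH (f u) (f v)]].

Definition wcol (f : {ffun VG -> VH}) : R := \prod_(v : VG) lam (f v).

Definition Z : R := \sum_(f in Hom) wcol f.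

Definition pmass (f : {ffun VG -> VH}) : R := wcol f / Z.

Definition prob (E : pred {ffun VG -> VH}) : R := \sum_(f in Hom | E f) pmass f.

Definition share (k : VH) (f : {ffun VG -> VH}) : R :=
  #|f @^-1: [set k]|%:R / #|VG|%:R.

Definition pbar (k : VH) : R :=
  #|VG|%:R^-1 * \sum_(v : VG) prob (fun f => f v == k).

End Colourings.

(* Main.v *)
Require Import Defs.
From HB Require Import structures.
From mathcomp Require Import all_boot all_order all_algebra.
From mathcomp Require Import reals sequences exp ring lra.
Set Implicit Arguments.
Unset Strict Implicit.
Unset Printing Implicit Defensive.
Import Order.TTheory GRing.Theory Num.Theory.
Local Open Scope ring_scope.

(** The number of vertices coloured [k] is controlled through its moment
    generating function.  Multiplying the weight of [k] by [expR t] multiplies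
    the weight of a colouring [f] by [expR (t * occupation k f)], so the
    expectation of this exponential is the ratio of the partition functions of
    the tilted and the original weights.

    Write [m] for the size of a colour class of the bipartite graph [G], so
    that [N = 2 m].  Colouring one class from [A] and the other from [B] for an
    optimal pair gives [eta ^+ m <= Z] ([Z_ge]).  Conversely
    [Z <= (2 ^ n) ^ (m / d) * eta ^ m] where [n] is the number of colours
    ([Z_le]): once one class [X] is coloured, the vertices of the other class
    are coloured independently, and [Z] becomes the mean of a product of
    functions, one for each [y] outside [X], depending only on the colours of
    the [d] neighbours of [y].  As each vertex of [X] is a neighbour of exactly
    [d] of the [y], Finner's generalisation of the inequality of Hölder
    ([finner]) bounds this mean by the product of the [L^d]-norms.  Each norm
    is that of the complete bipartite graph, where the colours occurring on
    one side form a set [A] and those on the other side a set [B] with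
    [A ~ B]; a union bound over [A] finishes the estimate.

    It remains to see how [eta] moves under tilting.  To first order in [t] the
    optimal pairs gain at most [2 * eta * a * t], with [a = aplus k] for
    [t >= 0] and [a = aminus k] for [t <= 0].  The other compatible pairs start
    below [eta] by a gap, so they overtake this bound by at most a quadratic
    term ([tilted_eta_le]).  Together
    [E expR (t * occupation k f) <= expR (N * (a t + C t^2 + L / d))] for
    [`|t| <= 1 / 2] ([mgf_occupation]).

    The first assertion is the resulting Chernoff bound for [t] of order [eps],
    the condition on [eps] making [L / d] at most a small multiple of [eps ^+ 2].  The
    second follows from Jensen's inequality with [t] of order [1 / sqrt d],
    which yields an error of order [1 / sqrt d], hence at most of order
    [zeta]. *)

(** * Generalised Hölder inequality on product spaces *)

Lemma powR_prod (R : realType) (I : finType) (P : pred I) (a : I -> R) (p : R) :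
  (forall i, P i -> 0 <= a i) ->
  (\prod_(i | P i) a i) `^ p = \prod_(i | P i) a i `^ p.
Proof.
move=> a0; suff [_ ->] : 0 <= \prod_(i | P i) a i /\
  (\prod_(i | P i) a i) `^ p = \prod_(i | P i) a i `^ p by [].
elim/big_ind2: _ => [|x1 x2 y1 y2 [x0 <-] [y0 <-]|i /a0 ai0].
- by rewrite ler01 powR1.
- by rewrite powRM // mulr_ge0.
- by rewrite ai0.
Qed.

Lemma powR_exprK (R : realType) (d : nat) (x : R) :
  (0 < d)%N -> 0 <= x -> (x ^+ d) `^ d%:R^-1 = x.
Proof.
move=> d0 x0; rewrite -powR_mulrn// -powRrM mulfV ?powRr1//.
by rewrite pnatr_eq0 -lt0n.
Qed.

Lemma geom_le_arith_mean (R : realType) (I : finType) (J : {set I}) (d : nat)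
    (a : I -> R) :
  (0 < d)%N -> #|J| = d -> (forall i, i \in J -> 0 <= a i) ->
  \prod_(i in J) a i `^ d%:R^-1 <= (\sum_(i in J) a i) / d%:R.
Proof.
move=> d0 Jd a0.
have sge0 : 0 <= (\sum_(i in J) a i) / d%:R.
  by rewrite mulr_ge0 ?invr_ge0 ?ler0n// sumr_ge0.
rewrite -powR_prod// -[leRHS](powR_exprK d0)//.
apply: ge0_ler_powR; rewrite ?invr_ge0 ?ler0n// ?nnegrE ?prodr_ge0 ?exprn_ge0//.
by have [] := @leif_AGM _ _ (mem J) a a0; rewrite Jd.
Qed.

(** This is the inequality of Hölder for [d] functions with all exponents equal
    to [d], the functions being written as [d]-th roots.  After normalisation
    it follows pointwise from the arithmetic-geometric mean inequality. *)
Lemma sum_holder (R : realType) (T I : finType) (p : T -> R) (J : {set I})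
    (d : nat) (g : I -> T -> R) :
  (0 < d)%N -> #|J| = d -> (forall t, 0 <= p t) ->
  (forall i t, 0 <= g i t) ->
  \sum_t p t * \prod_(i in J) g i t `^ d%:R^-1
    <= \prod_(i in J) (\sum_t p t * g i t) `^ d%:R^-1.
Proof.
move=> d0 Jd p0 g0; pose S i := \sum_t p t * g i t.
have S0 i : 0 <= S i by apply: sumr_ge0 => t _; rewrite mulr_ge0.
case: (boolP [exists i in J, S i == 0]) => [/exists_inP[i iJ /eqP Si]|].
  rewrite big1; first by apply: prodr_ge0 => j _; exact: powR_ge0.
  move=> t _.
  have /eqP := Si; rewrite psumr_eq0 => [|u _]; last by rewrite mulr_ge0.
  move=> /allP/(_ t); rewrite mem_index_enum mulf_eq0 => /(_ isT)/orP[/eqP->|].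
    by rewrite mul0r.
  move=> /eqP git; rewrite (bigD1 i)//= git powR0 ?mul0r ?mulr0//.
  by rewrite invr_neq0 // pnatr_eq0 -lt0n.
rewrite negb_exists_in => /forall_inP Sn0.
have Sgt0 i : i \in J -> 0 < S i by move=> iJ; rewrite lt0r Sn0// S0.
have -> : \prod_(i in J) (\sum_t p t * g i t) `^ d%:R^-1 =
          \prod_(i in J) S i `^ d%:R^-1 by [].
set P := \prod_(i in J) _.
have P0 : 0 <= P by apply: prodr_ge0 => i _; exact: powR_ge0.
(* After division by [S i] each function sums to one against [p], so the sum of
   their averages over [J] is one as well. *)
have -> : \sum_t p t * \prod_(i in J) g i t `^ d%:R^-1 =
    P * \sum_t p t * \prod_(i in J) (g i t / S i) `^ d%:R^-1.
  rewrite mulr_sumr; apply: eq_bigr => t _; rewrite mulrCA; congr (_ * _).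
  rewrite -big_split/=; apply: eq_bigr => i iJ.
  by rewrite -powRM ?divr_ge0// mulrCA mulfV ?mulr1// Sn0.
rewrite -[leRHS]mulr1 ler_wpM2l//.
have H t : p t * \prod_(i in J) (g i t / S i) `^ d%:R^-1 <=
    p t * ((\sum_(i in J) g i t / S i) / d%:R).
  by rewrite ler_wpM2l// geom_le_arith_mean// => i _; rewrite divr_ge0.
apply: le_trans (ler_sum _ (fun t _ => H t)) _.
under eq_bigr do rewrite mulrA mulr_sumr.
rewrite -mulr_suml exchange_big/=.
under eq_bigr => i iJ.
  under eq_bigr do rewrite mulrA.
  rewrite -mulr_suml mulfV; last exact: Sn0.
  over.
by rewrite sumr_const Jd mulfV// pnatr_eq0 -lt0n.
Qed.

Section ProductExpectation.
Variables (R : realType) (V C : finType) (mu : C -> R).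

Definition expect (F : {ffun V -> C} -> R) : R :=
  \sum_(x : {ffun V -> C}) (\prod_v mu (x v)) * F x.

Definition mix (S : {set V}) (x g : {ffun V -> C}) : {ffun V -> C} :=
  [ffun v => if v \in S then g v else x v].

(** Fixing [x] outside [S] and averaging over an independent copy inside [S] is
    the conditional expectation given the coordinates outside [S]. *)
Definition cond_expect (S : {set V}) (F : {ffun V -> C} -> R)
    (x : {ffun V -> C}) : R :=
  expect (fun g => F (mix S x g)).

Definition determined (S : {set V}) (F : {ffun V -> C} -> R) :=
  forall x y : {ffun V -> C}, {in S, x =1 y} -> F x = F y.

Lemma expect_prod (h : V -> C -> R) :
  expect (fun x => \prod_v h v (x v)) = \prod_v \sum_c mu c * h v c.
Proof.
by rewrite bigA_distr_bigA; apply: eq_bigr => x _; rewrite big_split.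
Qed.

Hypothesis mu_ge0 : forall c, 0 <= mu c.
Hypothesis mu_sum1 : \sum_c mu c = 1.

Lemma le_expect F G : (forall x, F x <= G x) -> expect F <= expect G.
Proof.
by move=> FG; apply: ler_sum => x _; rewrite ler_wpM2l// prodr_ge0.
Qed.

Lemma eq_expect F G : F =1 G -> expect F = expect G.
Proof. by move=> FG; apply: eq_bigr => x _; rewrite FG. Qed.

Lemma expectZ F a : expect (fun x => a * F x) = a * expect F.
Proof. by rewrite mulr_sumr; apply: eq_bigr => x _; rewrite mulrCA. Qed.

Lemma expect_sum (I : finType) (F : I -> {ffun V -> C} -> R) :
  expect (fun x => \sum_i F i x) = \sum_i expect (F i).
Proof.
by rewrite exchange_big/=; apply: eq_bigr => x _; rewrite mulr_sumr.
Qed.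

Lemma expect_cst a : expect (fun=> a) = a.
Proof.
rewrite /expect -mulr_suml.
have -> : \sum_(x : {ffun V -> C}) \prod_v mu (x v) = \prod_(v : V) \sum_c mu c.
  by rewrite bigA_distr_bigA.
by rewrite mu_sum1 big1 ?mul1r.
Qed.

Lemma expect_ge0 F : (forall x, 0 <= F x) -> 0 <= expect F.
Proof. by move=> F0; apply: sumr_ge0 => x _; rewrite mulr_ge0 ?prodr_ge0. Qed.

Lemma mixK S x g : mix S (mix S x g) (mix S g x) = x.
Proof. by apply/ffunP => v; rewrite !ffunE; case: (v \in S). Qed.

Lemma prod_mix S (h : C -> R) x g :
  (\prod_v h (mix S x g v)) * (\prod_v h (mix S g x v)) =
  (\prod_v h (x v)) * \prod_v h (g v).
Proof.
rewrite -!big_split/=; apply: eq_bigr => v _; rewrite !ffunE.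
by case: (v \in S); rewrite // mulrC.
Qed.

(** Exchanging the [S]-coordinates of two independent samples is an involution
    that preserves their joint law. *)
Lemma expect_cond S F : expect (cond_expect S F) = expect F.
Proof.
have -> : expect F = expect (fun x => expect (fun=> F x)).
  by apply: eq_expect => x; rewrite expect_cst.
rewrite /cond_expect /expect.
under eq_bigr do rewrite mulr_sumr.
under [RHS]eq_bigr do rewrite mulr_sumr.
rewrite !pair_big/=.
pose swap (p : {ffun V -> C} * {ffun V -> C}) := (mix S p.1 p.2, mix S p.2 p.1).
have swapK : involutive swap by case=> x g; rewrite /swap/= !mixK.
rewrite (reindex_inj (inv_inj swapK))/=; apply: eq_bigr => -[x g] _ /=.
by rewrite mixK !mulrA prod_mix.
Qed.

Lemma determined_cond v S F :
  determined S F -> determined (S :\ v) (cond_expect [set v] F).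
Proof.
move=> FS x y xy; apply: eq_expect => g; apply: FS => u uS.
by rewrite !ffunE !inE; case: eqVneq => // uv; apply: xy; rewrite !inE uv.
Qed.

Lemma cond_expect_notin v S F x :
  determined S F -> v \notin S -> cond_expect [set v] F x = F x.
Proof.
move=> FS vS; rewrite -[RHS]expect_cst; apply: eq_expect => g; apply: FS => u uS.
by rewrite ffunE inE; case: eqVneq uS vS => // -> ->.
Qed.

Lemma determined0 F x : determined set0 F -> F x = expect F.
Proof.
move=> F0; rewrite -(expect_cst (F x)); apply: eq_expect => y.
by apply: F0 => u; rewrite inE.
Qed.

(** The coordinates in [s] are averaged out one after the other.  Averaging over
    [v] involves just the [d] factors that depend on [v], and Hölder's
    inequality replaces each of them by its conditional expectation, which no
    longer depends on [v]. *)
Lemma finner (I : finType) (P : {set I}) (d : nat) (s : seq V)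
    (D : I -> {set V}) (g : I -> {ffun V -> C} -> R) :
  (0 < d)%N -> uniq s -> (forall i x, 0 <= g i x) ->
  (forall i, i \in P -> determined (D i) (g i)) ->
  (forall i, i \in P -> {subset D i <= s}) ->
  (forall v, v \in s -> #|[set i in P | v \in D i]| = d) ->
  expect (fun x => \prod_(i in P) g i x `^ d%:R^-1)
    <= \prod_(i in P) expect (g i) `^ d%:R^-1.
Proof.
move=> d0; elim: s D g => [|v s IHs] D g /=.
  move=> _ g0 gD Ds _.
  rewrite (@eq_expect _ (fun=> \prod_(i in P) expect (g i) `^ d%:R^-1)).
    by rewrite expect_cst.
  move=> x; apply: eq_bigr => i iP; rewrite -(@determined0 _ x)//.
  suff <- : D i = set0 by exact: gD.
  by apply/setP => u; rewrite inE; apply/negP => /(Ds _ iP).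
case/andP=> vs us g0 gD Ds cD.
under [leRHS]eq_bigr do rewrite -(expect_cond [set v]).
rewrite -(expect_cond [set v]).
apply: le_trans (IHs (fun i => D i :\ v) _ us _ _ _ _); first last.
- move=> u us'; rewrite -(cD u) ?inE ?us' ?orbT//; apply: eq_card => i.
  by rewrite !inE; case: eqVneq us' vs => // -> ->.
- move=> i iP u; rewrite !inE => /andP[uv /(Ds _ iP)].
  by rewrite inE (negPf uv).
- by move=> i iP; exact/determined_cond/gD.
- by move=> i x; exact: expect_ge0.
apply: le_expect => x.
(* Only the [d] factors in [J] see the coordinate [v] *)
pose J := [set i in P | v \in D i].
have PJ (F : I -> R) : \prod_(i in P) F i =
    (\prod_(i in J) F i) * \prod_(i in P :\: J) F i.
  rewrite (big_setID J)/=; congr (_ * _); apply: eq_bigl => i.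
  by rewrite !inE; case: (i \in P).
rewrite PJ.
have -> : \prod_(i in P :\: J) cond_expect [set v] (g i) x `^ d%:R^-1 =
    \prod_(i in P :\: J) g i x `^ d%:R^-1.
  apply: eq_bigr => i; rewrite !inE => /andP[+ iP]; rewrite iP/= => vD.
  by rewrite (cond_expect_notin _ (gD _ iP)).
set Q := \prod_(i in P :\: J) _.
have Q0 : 0 <= Q by apply: prodr_ge0 => i _; exact: powR_ge0.
have -> : cond_expect [set v] (fun x => \prod_(i in P) g i x `^ d%:R^-1) x =
    Q * expect (fun h => \prod_(i in J) g i (mix [set v] x h) `^ d%:R^-1).
  rewrite -expectZ; apply: eq_expect => h; rewrite PJ mulrC; congr (_ * _).
  apply: eq_bigr => i; rewrite !inE => /andP[+ iP]; rewrite iP/= => vD.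
  congr (_ `^ _); apply: (gD _ iP) => u uD; rewrite ffunE inE.
  by case: eqVneq uD vD => // -> ->.
rewrite mulrC ler_wpM2r//.
apply: sum_holder => //; first by apply: cD; rewrite inE eqxx.
by move=> h; exact: prodr_ge0.
Qed.

End ProductExpectation.

(** * Bounds on the partition function *)

Lemma natr_forall (R : realType) (T : finType) (P : pred T) :
  ([forall t, P t])%:R = \prod_t (P t)%:R :> R.
Proof.
case: forallP => [Pt|/forallP/forallPn[t /negPf Pt]].
  by rewrite big1// => t _; rewrite Pt.
by rewrite (bigD1 t)//= Pt mul0r.
Qed.

Definition nbrs (V : finType) (e : rel V) (v : V) : {set V} := [set u | e v u].

Definition common_nbrs (C : finType) (eH : rel C) (A : {set C}) : {set C} :=
  [set c | [forall a in A, eH a c]].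

Lemma compat_common_nbrs (C : finType) (eH : rel C) A :
  compat eH A (common_nbrs eH A).
Proof.
apply/forall_inP => a aA; apply/forall_inP => c.
by rewrite inE => /forall_inP; exact.
Qed.

(** Both classes are incident with every edge, and each vertex lies on [d]
    edges. *)
Lemma bipartite_class_card (V : finType) (eG : rel V) (d : nat) (X : {set V}) :
  (0 < d)%N -> symmetric eG -> regular eG d ->
  (forall u v, eG u v -> (u \in X) != (v \in X)) ->
  #|X| = #|~: X|.
Proof.
move=> d0 symG regG bip; apply/eqP; rewrite -(eqn_pmul2r d0) -!sum_nat_const.
have deg (S : {set V}) : (forall u v, eG u v -> (u \in S) != (v \in S)) ->
    (\sum_(u in S) d = \sum_(u in S) \sum_(v in ~: S) eG u v)%N.
  move=> bS; apply: eq_bigr => u uS.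
  rewrite -(regG u) -sum1_card big_mkcond/= [RHS]big_mkcond/=.
  apply: eq_bigr => v _; rewrite !inE; case: (boolP (eG u v)) => [/bS|].
    by rewrite uS; case: (v \in S).
  by rewrite if_same.
rewrite (deg X)// (deg (~: X)) ?setCK => [|u v /bip].
  rewrite exchange_big/=; apply/eqP; apply: eq_bigr => u _.
  by apply: eq_bigr => v _; rewrite symG.
by rewrite !inE; case: (u \in X); case: (v \in X).
Qed.

Section PartitionFunctionBound.
Variables (R : realType) (V C : finType) (eG : rel V) (eH : rel C).
Variables (mu : C -> R).
Hypothesis mu_ge0 : forall c, 0 <= mu c.
Hypothesis mu_sum1 : \sum_c mu c = 1.

(** If [D] is the neighbourhood of a vertex [y] and [x] colours [D], this is the
    probability that an independent colour of [y] is compatible with [x]. *)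
Definition extension_mass (D : {set V}) (x : {ffun V -> C}) : R :=
  wset mu (common_nbrs eH (x @: D)).

Lemma wset_ge0 A : 0 <= wset mu A.
Proof. exact: sumr_ge0. Qed.

Lemma wset_indicator A : wset mu A = \sum_c mu c * (c \in A)%:R.
Proof.
rewrite /wset big_mkcond/=; apply: eq_bigr => c _.
by case: (c \in A); rewrite ?mulr1 ?mulr0.
Qed.

Lemma expect_all_in (D : {set V}) (A : {set C}) :
  expect mu (fun x => [forall v in D, x v \in A]%:R) = wset mu A ^+ #|D|.
Proof.
under eq_expect do rewrite natr_forall.
rewrite (expect_prod mu (fun v c => ((v \in D) ==> (c \in A))%:R)).
rewrite -prodr_const big_mkcond [RHS]big_mkcond/=; apply: eq_bigr => v _.
case: (v \in D) => /=; first by rewrite wset_indicator.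
by under eq_bigr do rewrite mulr1.
Qed.

(** The left side is the normalised partition function of the complete bipartite
    graph with classes of size [#|D|].  For each set [A] of colours, the
    colourings that use exactly the colours in [A] on [D] contribute at most
    [(mu(A) * mu(B)) ^+ #|D|], with [B] the set of common neighbours of [A]. *)
Lemma expect_extension_mass (D : {set V}) (q : R) :
  (forall A B, compat eH A B -> wset mu A * wset mu B <= q) ->
  expect mu (fun x => extension_mass D x ^+ #|D|)
    <= (2 ^ #|C|)%N%:R * q ^+ #|D|.
Proof.
move=> qP.
pose F A (x : {ffun V -> C}) : R :=
  wset mu (common_nbrs eH A) ^+ #|D| * [forall v in D, x v \in A]%:R.
apply: (@le_trans _ _ (expect mu (fun x => \sum_A F A x))).
  apply: le_expect => // x; rewrite (bigD1 (x @: D))//= /F.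
  have -> : [forall v in D, x v \in x @: D].
    by apply/forall_inP => v vD; exact: imset_f.
  rewrite mulr1 lerDl sumr_ge0// => A _.
  by rewrite mulr_ge0 ?ler0n// exprn_ge0 ?wset_ge0.
rewrite expect_sum.
apply: (@le_trans _ _ (\sum_(A : {set C}) q ^+ #|D|)).
  apply: ler_sum => A _; rewrite expectZ expect_all_in -exprMn mulrC.
  rewrite lerXn2r// ?nnegrE ?mulr_ge0 ?wset_ge0//.
    by apply: le_trans (qP _ _ (compat_common_nbrs eH A)); rewrite mulr_ge0 ?wset_ge0.
  by apply: qP; exact: compat_common_nbrs.
have cardS : #|{set C}| = (2 ^ #|C|)%N.
  by rewrite -[LHS]cardsT -powersetT card_powerset cardsT.
by rewrite sumr_const cardS mulr_natl.
Qed.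

(** Given the colours on [X], the events that [y] is compatible with its
    neighbours are independent for [y] outside [X]. *)
Lemma expect_Hom (X : {set V}) :
  symmetric eG -> symmetric eH ->
  (forall u v, eG u v -> (u \in X) != (v \in X)) ->
  expect mu (fun x => (x \in Defs.Hom eH eG)%:R) =
  expect mu (fun x => \prod_(y in ~: X) extension_mass (nbrs eG y) x).
Proof.
move=> symG symH bip; rewrite -(expect_cond mu_sum1 (~: X)).
apply: eq_expect => x.
pose h v c := (v \in ~: X) ==> (c \in common_nbrs eH (x @: nbrs eG v)).
have -> : cond_expect mu (~: X) (fun x => (x \in Defs.Hom eH eG)%:R) x =
    expect mu (fun g => \prod_v (h v (g v))%:R).
  apply: eq_expect => g; rewrite -natr_forall; congr (nat_of_bool _)%:R.
  rewrite inE; apply/forallP/forallP => [H v|H u].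
    apply/implyP => vX; rewrite inE; apply/forall_inP => _ /imsetP[u + ->].
    rewrite inE => euv; have := bip _ _ euv.
    have := vX; rewrite inE => /negPf ->; case uX: (u \in X) => // _.
    by move: (H v) => /forallP/(_ u); rewrite euv/= !ffunE vX inE uX symH.
  apply/forallP => v; apply/implyP => euv; have := bip _ _ euv.
  have nb (w w' : V) : w \in ~: X -> eG w w' -> eH (x w') (g w).
    move=> wX ww'; move: (H w); rewrite /h wX/= inE => /forall_inP; apply.
    by apply/imsetP; exists w' => //; rewrite inE.
  rewrite !ffunE !inE; case: (boolP (u \in X)); case: (boolP (v \in X)) => //=.
    by move=> vX uX _; apply: nb; rewrite ?inE// symG.
  by move=> vX uX _; rewrite symH; apply: nb; rewrite ?inE// symG.
rewrite (expect_prod mu (fun v c => (h v c)%:R)) [RHS]big_mkcond/=.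
apply: eq_bigr => v _; rewrite /h; case: (v \in ~: X) => /=.
  by rewrite /extension_mass wset_indicator.
by under eq_bigr do rewrite mulr1.
Qed.

(** The vertices of [X] are averaged out with [finner]: each of them has exactly
    [d] neighbours outside [X]. *)
Lemma expect_Hom_le (d : nat) (X : {set V}) (q : R) :
  (0 < d)%N -> symmetric eG -> symmetric eH -> regular eG d ->
  (forall u v, eG u v -> (u \in X) != (v \in X)) ->
  (forall A B, compat eH A B -> wset mu A * wset mu B <= q) ->
  expect mu (fun x => (x \in Defs.Hom eH eG)%:R)
    <= ((2 ^ #|C|)%N%:R `^ d%:R^-1 * q) ^+ #|~: X|.
Proof.
move=> d0 symG symH regG bip qP; rewrite (expect_Hom symG symH bip).
have q0 : 0 <= q.
  apply: le_trans (qP _ _ (compat_common_nbrs eH set0)).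
  by rewrite mulr_ge0 ?wset_ge0.
pose g y x := extension_mass (nbrs eG y) x ^+ d.
have -> : expect mu (fun x => \prod_(y in ~: X) extension_mass (nbrs eG y) x) =
    expect mu (fun x => \prod_(y in ~: X) g y x `^ d%:R^-1).
  apply: eq_expect => x; apply: eq_bigr => y _.
  by rewrite powR_exprK// wset_ge0.
apply: (@le_trans _ _ (\prod_(y in ~: X) expect mu (g y) `^ d%:R^-1)).
  apply: (@finner _ _ _ _ mu_ge0 mu_sum1 _ _ _ (enum X) (nbrs eG)) => //.
  - exact: enum_uniq.
  - by move=> y x; rewrite exprn_ge0 ?wset_ge0.
  - move=> y _ x x' xx'; rewrite /g /extension_mass.
    congr (wset _ (common_nbrs _ _) ^+ _).
    exact: eq_in_imset.
  - move=> y; rewrite inE => /negPf yX u; rewrite inE mem_enum => /bip.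
    by rewrite yX; case: (u \in X).
  - move=> v; rewrite mem_enum => vX; rewrite -(regG v); apply: eq_card => u.
    rewrite !inE symG andb_idl// => /bip; rewrite vX.
    by case: (u \in X).
rewrite -prodr_const; apply: ler_prod => y _; rewrite powR_ge0/=.
rewrite -[q in leRHS](powR_exprK d0 q0) -powRM ?ler0n ?exprn_ge0//.
apply: ge0_ler_powR; rewrite ?invr_ge0 ?ler0n// ?nnegrE.
- by apply: expect_ge0 => // x; rewrite exprn_ge0 ?wset_ge0.
- by rewrite mulr_ge0 ?ler0n ?exprn_ge0.
by rewrite /g -(regG y); exact: expect_extension_mass.
Qed.

End PartitionFunctionBound.

Section PartitionFunction.
Variables (R : realType) (VH : finType) (eH : rel VH).
Variables (VG : finType) (eG : rel VG) (d : nat) (X : {set VG}).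
Hypothesis symH : symmetric eH.
Hypothesis d_gt0 : (0 < d)%N.
Hypothesis symG : symmetric eG.
Hypothesis regG : regular eG d.
Hypothesis bipX : forall u v, eG u v -> (u \in X) != (v \in X).

Lemma card_double : #|VG| = (#|~: X| + #|~: X|)%N.
Proof. by rewrite -{1}(bipartite_class_card d_gt0 symG regG bipX) cardsC. Qed.

(** Dividing the weights by their sum turns [Z] into a probability; the powers of
    the sum cancel because the number of vertices is twice [#|~: X|]. *)
Lemma Z_le (lam : VH -> R) (q : R) :
  (forall i, 0 <= lam i) -> 0 < \sum_i lam i ->
  (forall A B, compat eH A B -> wset lam A * wset lam B <= q) ->
  Z eH lam eG <= ((2 ^ #|VH|)%N%:R `^ d%:R^-1 * q) ^+ #|~: X|.
Proof.
set W := \sum_i lam i => lam0 W0 qP.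
pose mu i := lam i / W.
have mu0 i : 0 <= mu i by rewrite divr_ge0// ltW.
have mu1 : \sum_i mu i = 1 by rewrite -mulr_suml mulfV ?gt_eqF.
have wmu A : wset mu A = wset lam A / W by rewrite /wset mulr_suml.
have -> : Z eH lam eG = W ^+ #|VG| * expect mu (fun f => (f \in Defs.Hom eH eG)%:R).
  rewrite mulr_sumr /Z big_mkcond/=; apply: eq_bigr => f _.
  rewrite mulrA prodf_div prodr_const (mulrC (W ^+ _)) divfK ?expf_neq0 ?gt_eqF//.
  by case: ifP; rewrite ?mulr1 ?mulr0.
have -> : ((2 ^ #|VH|)%N%:R `^ d%:R^-1 * q) ^+ #|~: X| =
    W ^+ #|VG| * ((2 ^ #|VH|)%N%:R `^ d%:R^-1 * (q / W ^+ 2)) ^+ #|~: X|.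
  rewrite card_double addnn -mul2n exprM -exprMn; congr (_ ^+ _).
  by field; rewrite gt_eqF.
rewrite ler_wpM2l ?exprn_ge0 ?(ltW W0)//.
apply: expect_Hom_le => // A B AB; rewrite !wmu.
have -> : wset lam A / W * (wset lam B / W) = wset lam A * wset lam B / W ^+ 2.
  by field; rewrite gt_eqF.
by rewrite ler_wpM2r ?qP// invr_ge0 exprn_ge0// ltW.
Qed.

(** All colourings that map [X] into [A] and its complement into [B] are
    homomorphisms. *)
Lemma Z_ge (lam : VH -> R) (A B : {set VH}) :
  (forall i, 0 <= lam i) -> compat eH A B ->
  (wset lam A * wset lam B) ^+ #|~: X| <= Z eH lam eG.
Proof.
move=> lam0 AB; pose S v := if v \in X then A else B.
have -> : (wset lam A * wset lam B) ^+ #|~: X| =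
    \prod_v \sum_i lam i * (i \in S v)%:R.
  rewrite exprMn -{1}(bipartite_class_card d_gt0 symG regG bipX).
  rewrite [RHS](bigID (mem X))/= -!prodr_const; congr (_ * _).
    by apply: eq_bigr => v vX; rewrite wset_indicator /S vX.
  by apply: eq_big => v; rewrite ?inE// => /negPf vX; rewrite wset_indicator /S vX.
rewrite bigA_distr_bigA /Z [leRHS]big_mkcond/=; apply: ler_sum => f _.
rewrite big_split/= -natr_forall; case: forallP => fS; last first.
  by rewrite mulr0; case: ifP => // _; exact: prodr_ge0.
rewrite mulr1 inE ifT//; apply/forallP => u; apply/forallP => v; apply/implyP.
move=> /bipX; move: (fS u) (fS v); rewrite /S.
have HAB a b : a \in A -> b \in B -> eH a b.
  by move=> aA bB; move: AB => /forall_inP/(_ a aA)/forall_inP/(_ b bB).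
case: (u \in X); case: (v \in X) => // fu fv _; first exact: HAB.
by rewrite symH; exact: HAB.
Qed.

End PartitionFunction.

(** * The optimal value under a tilt of one weight *)

Lemma expR_le_quadratic (R : realType) (t : R) :
  `|t| <= 1 / 2 -> expR t <= 1 + t + 2 * t ^+ 2.
Proof.
rewrite ler_norml => /andP[t1 t2].
have e1 := expR_ge1Dx (- t); rewrite expRN in e1.
have e0 := expR_gt0 t.
rewrite -[leLHS](invrK) -[leRHS](invrK) lef_pV2 ?posrE ?invr_gt0//; last first.
  by nra.
apply: le_trans e1; rewrite -[leLHS]mul1r ler_pdivrMr; nra.
Qed.

Section Tilting.
Variables (R : realType) (VH : finType) (eH : rel VH) (lam : VH -> R).
Hypothesis edgeH : exists i j : VH, eH i j.
Hypothesis lam_gt0 : forall i, 0 < lam i.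

Let W : R := \sum_i lam i.
Let eta := Defs.eta eH lam.

Definition tilt (k : VH) (t : R) (i : VH) : R := lam i * expR (t * (i == k)%:R).

Let lam_ge0 i : 0 <= lam i.
Proof. exact: ltW. Qed.

Lemma wset_le A : wset lam A <= W.
Proof.
by rewrite /W (bigID (mem A))/= lerDl sumr_ge0.
Qed.

Lemma lam_le_wset k (A : {set VH}) : k \in A -> lam k <= wset lam A.
Proof.
by move=> kA; rewrite /wset (bigD1 k)//= lerDl sumr_ge0.
Qed.

Lemma le_eta A B : compat eH A B -> wset lam A * wset lam B <= eta.
Proof.
move=> AB; have [i _ [e H]] :=
  maxoverP (fun AB => wset lam AB.1 * wset lam AB.2) (compat_pairs_neq0 eH).
by rewrite /eta /Defs.eta e; apply: (H (A, B)); rewrite inE.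
Qed.

Lemma eta_gt0 : 0 < eta.
Proof.
have [i [j ij]] := edgeH.
apply: (@lt_le_trans _ _ (wset lam [set i] * wset lam [set j])).
  by rewrite /wset !big_set1 mulr_gt0.
apply: le_eta; apply/forall_inP => a /set1P->; apply/forall_inP => b /set1P->.
exact: ij.
Qed.

Lemma W_gt0 : 0 < W.
Proof.
have [i _] := edgeH; apply: lt_le_trans (lam_gt0 i) _.
by rewrite /W (bigD1 i)//= lerDl sumr_ge0.
Qed.

Lemma eta_le : eta <= W ^+ 2.
Proof.
have [i _ [e _]] :=
  maxoverP (fun AB => wset lam AB.1 * wset lam AB.2) (compat_pairs_neq0 eH).
by rewrite /eta /Defs.eta e expr2; apply: ler_pM; rewrite ?(wset_ge0 lam_ge0) ?wset_le.
Qed.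

Lemma kweight_ge0 k AB : 0 <= kweight lam k AB.
Proof.
by rewrite addr_ge0// !mulr_ge0 ?(wset_ge0 lam_ge0) ?ler0n// ltW.
Qed.

(** Each of the two terms of [kweight] is at most the product of the weights,
    as [lam k] is at most the weight of a set containing [k].  Hence the numbers
    [aplus] and [aminus] lie in the unit interval. *)
Lemma kweight_le k AB : kweight lam k AB <= 2 * (wset lam AB.1 * wset lam AB.2).
Proof.
case: AB => A B; rewrite /kweight/=.
have bound (D E : {set VH}) :
    wset lam D * lam k * (k \in E)%:R <= wset lam D * wset lam E.
  case: (boolP (k \in E)) => [kE|_].
    by rewrite mulr1 ler_wpM2l ?(wset_ge0 lam_ge0) ?lam_le_wset.
  by rewrite mulr0 mulr_ge0 ?(wset_ge0 lam_ge0).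
by have := bound A B; have := bound B A; lra.
Qed.

Lemma optimalP AB : AB \in optimal_pairs eH lam ->
  compat eH AB.1 AB.2 /\ wset lam AB.1 * wset lam AB.2 = eta.
Proof. by rewrite inE => /andP[-> /eqP]. Qed.

Lemma kweight_le_aplus k AB : AB \in optimal_pairs eH lam ->
  kweight lam k AB <= 2 * eta * aplus eH lam k.
Proof.
move=> ABo; have [i _ [e H]] :=
  maxoverP (kweight lam k) (optimal_pairs_neq0 eH lam).
by rewrite /aplus e mulrC divfK ?H// mulf_neq0// gt_eqF// eta_gt0.
Qed.

Lemma aminus_le_kweight k AB : AB \in optimal_pairs eH lam ->
  2 * eta * aminus eH lam k <= kweight lam k AB.
Proof.
move=> ABo; have [i _ [e H]] :=
  minoverP (kweight lam k) (optimal_pairs_neq0 eH lam).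
by rewrite /aminus e mulrC divfK ?H// mulf_neq0// gt_eqF// eta_gt0.
Qed.

Lemma kweight_frac k AB : AB \in optimal_pairs eH lam ->
  0 <= kweight lam k AB / (2 * eta) <= 1.
Proof.
move=> /optimalP[_ e]; have e2 : 0 < 2 * eta by rewrite mulr_gt0 ?eta_gt0.
rewrite divr_ge0 ?kweight_ge0 ?(ltW e2)//=.
by rewrite ler_pdivrMr// mul1r -e kweight_le.
Qed.

Lemma aplus_itv k : 0 <= aplus eH lam k <= 1.
Proof.
have [i io [e _]] := maxoverP (kweight lam k) (optimal_pairs_neq0 eH lam).
by rewrite /aplus e kweight_frac.
Qed.

Lemma aminus_itv k : 0 <= aminus eH lam k <= 1.
Proof.
have [i io [e _]] := minoverP (kweight lam k) (optimal_pairs_neq0 eH lam).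
by rewrite /aminus e kweight_frac.
Qed.

Lemma wset_tilt k t A :
  wset (tilt k t) A = wset lam A + (expR t - 1) * (lam k * (k \in A)%:R).
Proof.
rewrite /wset; have [kA|kA] := boolP (k \in A).
  rewrite (bigD1 k)//= [in RHS](bigD1 k)//= /tilt eqxx !mulr1.
  under eq_bigr => i /andP[_ /negPf ik] do rewrite ik mulr0 expR0 mulr1.
  by ring.
rewrite !mulr0 addr0; apply: eq_bigr => i iA; rewrite /tilt.
by case: eqVneq iA kA => [-> ->//|_ _ _]; rewrite mulr0 expR0 mulr1.
Qed.

(** [kweight] is the derivative of the product of the two weights in the
    direction of the tilt. *)
Lemma wset_tilt_pair k t A B : `|t| <= 1 / 2 ->
  wset (tilt k t) A * wset (tilt k t) B <=
  wset lam A * wset lam B + t * kweight lam k (A, B) + 8 * W ^+ 2 * t ^+ 2.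
Proof.
move=> ht; rewrite !wset_tilt /kweight/=.
set al := wset lam A; set be := wset lam B; set de := expR t - 1.
set a := lam k * _; set b := lam k * (k \in B)%:R.
have le1 : t <= de by have := expR_ge1Dx t; rewrite /de; lra.
have le2 : de <= t + 2 * t ^+ 2.
  by have := expR_le_quadratic ht; rewrite /de; lra.
have sub (D : {set VH}) : 0 <= lam k * (k \in D)%:R <= wset lam D.
  rewrite mulr_ge0 ?ler0n ?(ltW (lam_gt0 k))//=; case: (boolP (k \in D)) => kD.
    by rewrite mulr1 lam_le_wset.
  by rewrite mulr0 (wset_ge0 lam_ge0).
have /andP[a0 aal] := sub A; have /andP[b0 bbe] := sub B.
rewrite -/a -/b -/al -/be in a0 aal b0 bbe.
have alW : al <= W := wset_le A; have beW : be <= W := wset_le B.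
have -> : al * lam k * (k \in B)%:R + be * lam k * (k \in A)%:R =
  al * b + be * a by rewrite /a /b; ring.
have W0 := ltW W_gt0.
have ab : a * b <= W ^+ 2 by rewrite expr2 ler_pM//; lra.
have ab0 : 0 <= a * b by rewrite mulr_ge0.
have alb : al * b <= W ^+ 2 by rewrite expr2 ler_pM//; lra.
have bea : be * a <= W ^+ 2 by rewrite expr2 ler_pM//; lra.
have de2 : de ^+ 2 <= 4 * t ^+ 2.
  move: ht; rewrite ler_norml => /andP[t1 t2].
  have [t0|t0] := lerP 0 t.
    have d2 : 0 <= 2 * t - de by nra.
    have d3 : 0 <= 2 * t + de by nra.
    by have := mulr_ge0 d2 d3; lra.
  have d2 : 0 <= de - 2 * t by nra.
  have d3 : 0 <= - de - 2 * t by nra.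
  by have := mulr_ge0 d2 d3; lra.
have kw0 : 0 <= al * b + be * a.
  by rewrite addr_ge0// mulr_ge0//; lra.
have -> : (al + de * a) * (be + de * b) =
  al * be + de * (al * b + be * a) + de ^+ 2 * (a * b) by ring.
have h1 : de * (al * b + be * a) <=
    t * (al * b + be * a) + 2 * t ^+ 2 * (al * b + be * a).
  by rewrite -mulrDl ler_wpM2r.
have t20 : 0 <= t ^+ 2 by exact: sqr_ge0.
have h2 : 2 * t ^+ 2 * (al * b + be * a) <= 2 * t ^+ 2 * (2 * W ^+ 2).
  by rewrite ler_wpM2l//; lra.
have h3 : de ^+ 2 * (a * b) <= 4 * t ^+ 2 * W ^+ 2.
  by rewrite ler_pM// sqr_ge0.
lra.
Qed.

Definition suboptimal_pairs :=
  [set AB : {set VH} * {set VH} |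
    compat eH AB.1 AB.2 & wset lam AB.1 * wset lam AB.2 != eta].

(** A pair with gap [g] and slope at most [K = 2 * W ^+ 2] satisfies
    [K * `|t| - g <= K ^+ 2 / (4 * g) * t ^+ 2]; summing over the pairs is a
    bound valid for all of them. *)
Definition gap_cost : R := \sum_(AB in suboptimal_pairs)
  (2 * W ^+ 2) ^+ 2 / (4 * (eta - wset lam AB.1 * wset lam AB.2)).

(** The summand 1 keeps the optimal tilt [eps / (2 * curvature)] of the Chernoff
    bound within [1 / 2] for [eps <= 1]. *)
Definition curvature : R := 1 + (8 * W ^+ 2 + gap_cost) / (2 * eta).

Lemma gap_gt0 AB : AB \in suboptimal_pairs ->
  0 < eta - wset lam AB.1 * wset lam AB.2.
Proof.
rewrite inE => /andP[ABc ne]; rewrite subr_gt0 lt_neqAle ne/=.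
exact: le_eta.
Qed.

Lemma gap_cost_ge0 : 0 <= gap_cost.
Proof.
apply: sumr_ge0 => AB /gap_gt0 g0.
by rewrite divr_ge0 ?exprn_even_ge0// mulr_ge0// ltW.
Qed.

Lemma curvature_ge1 : 1 <= curvature.
Proof.
rewrite lerDl divr_ge0//; last by rewrite mulr_ge0// ltW// eta_gt0.
by rewrite addr_ge0 ?gap_cost_ge0// mulr_ge0// sqr_ge0.
Qed.

(** The bound is immediate for optimal pairs.  For the others the gap pays for a
    wrong slope while [t] is small, and the quadratic term pays when [t] is
    large. *)
Lemma linear_term_le k (t a : R) A B :
  0 <= a <= 1 -> compat eH A B ->
  (forall AB, AB \in optimal_pairs eH lam ->
     t * kweight lam k AB <= t * (2 * eta * a)) ->
  wset lam A * wset lam B + t * kweight lam k (A, B) <=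
  eta + t * (2 * eta * a) + gap_cost * t ^+ 2.
Proof.
move=> /andP[a0 a1] AB opt.
have e0 := eta_gt0; have eW := eta_le; have g0 := gap_cost_ge0.
have [abe|abe] := eqVneq (wset lam A * wset lam B) eta.
  have /opt : (A, B) \in optimal_pairs eH lam by rewrite inE AB/= abe eqxx.
  by have := mulr_ge0 g0 (sqr_ge0 t); rewrite abe; lra.
have ABs : (A, B) \in suboptimal_pairs by rewrite inE AB.
have gam0 := gap_gt0 ABs; rewrite /= in gam0.
set gam := eta - wset lam A * wset lam B in gam0.
set K := 2 * W ^+ 2.
have costAB : K ^+ 2 / (4 * gam) <= gap_cost.
  rewrite /gap_cost (bigD1 (A, B))//= lerDl sumr_ge0// => CD /andP[/gap_gt0 CD0 _].
  by rewrite divr_ge0 ?sqr_ge0// mulr_ge0// ltW.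
have amgm : `|t| * K <= gam + K ^+ 2 / (4 * gam) * t ^+ 2.
  have -> : gam + K ^+ 2 / (4 * gam) * t ^+ 2 =
      (gam - `|t| * K / 2) ^+ 2 / gam + `|t| * K.
    have -> : t ^+ 2 = `|t| ^+ 2 by rewrite real_normK ?num_real.
    by field; rewrite gt_eqF.
  by rewrite lerDr divr_ge0 ?sqr_ge0// ltW.
have kw0 := kweight_ge0 k (A, B).
have := kweight_le k (A, B); have := le_eta AB => /= ABe kw1.
have ea : eta * a <= eta by rewrite ler_piMr// ltW.
have ea0 : 0 <= eta * a by rewrite mulr_ge0// ltW.
have : t * (kweight lam k (A, B) - 2 * eta * a) <= `|t| * K.
  apply: le_trans (ler_norm _) _; rewrite normrM ler_wpM2l//.
  by rewrite ler_norml /K; apply/andP; split; lra.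
have := ler_wpM2r (sqr_ge0 t) costAB.
move: amgm; set c := K ^+ 2 / _ * _; set q := `|t| * K => amgm cost slope.
have : q <= eta - wset lam A * wset lam B + gap_cost * t ^+ 2.
  by apply: le_trans amgm _; rewrite lerD2l.
lra.
Qed.

(** The factor 2 in the exponent makes the rate one per vertex once the bound is
    raised to half the number of vertices. *)
Lemma tilted_eta_le k (t a : R) A B :
  `|t| <= 1 / 2 -> 0 <= a <= 1 -> compat eH A B ->
  (forall AB, AB \in optimal_pairs eH lam ->
     t * kweight lam k AB <= t * (2 * eta * a)) ->
  wset (tilt k t) A * wset (tilt k t) B <=
  eta * expR (2 * (a * t + curvature * t ^+ 2)).
Proof.
move=> ht ha AB opt; apply: le_trans (wset_tilt_pair k A B ht) _.
have e0 := eta_gt0; have lin := linear_term_le ha AB opt.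
apply: (@le_trans _ _ (eta * (1 + 2 * (a * t + curvature * t ^+ 2)))); last first.
  by rewrite ler_wpM2l ?expR_ge1Dx// ltW.
have -> : eta * (1 + 2 * (a * t + curvature * t ^+ 2)) =
   eta + t * (2 * eta * a) + gap_cost * t ^+ 2 + 8 * W ^+ 2 * t ^+ 2 +
   2 * eta * t ^+ 2.
  by rewrite /curvature; field; rewrite gt_eqF.
by have := mulr_ge0 (ltW e0) (sqr_ge0 t); lra.
Qed.

End Tilting.

(** * The number of vertices of a given colour *)

Section Occupation.
Variables (R : realType) (VH : finType) (eH : rel VH) (lam : VH -> R).
Hypothesis symH : symmetric eH.
Hypothesis edgeH : exists i j : VH, eH i j.
Hypothesis lam_gt0 : forall i, 0 < lam i.
Variables (VG : finType) (eG : rel VG) (d : nat).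
Hypothesis d_gt0 : (0 < d)%N.
Hypothesis VG_gt0 : (0 < #|VG|)%N.
Hypothesis symG : symmetric eG.
Hypothesis regG : regular eG d.
Hypothesis bipG : bipartite eG.

Notation homs := (Defs.Hom eH eG).
Notation mass := (pmass eH lam eG).

Definition mean (F : {ffun VG -> VH} -> R) : R := \sum_(f in homs) mass f * F f.

Definition occupation (k : VH) (f : {ffun VG -> VH}) : R :=
  #|f @^-1: [set k]|%:R.

(** The exponential rate per vertex, multiplied by [d], of the factor
    [(2 ^ #|VH|) ^ (m / d)] of [Z_le], with [m] half the number of vertices. *)
Definition union_loss : R := #|VH|%:R * ln 2 / 2.

Let lam_ge0 i : 0 <= lam i.
Proof. exact: ltW. Qed.

Lemma Z_gt0 : 0 < Z eH lam eG.
Proof.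
have [X bipX] := bipG.
have [AB ABo] := set0Pn _ (optimal_pairs_neq0 eH lam).
have [ABc ABe] := optimalP ABo.
apply: lt_le_trans (Z_ge symH d_gt0 symG regG bipX lam_ge0 ABc).
by rewrite ABe exprn_gt0// eta_gt0.
Qed.

Lemma pmass_ge0 f : 0 <= mass f.
Proof. by rewrite divr_ge0 ?(ltW Z_gt0)// prodr_ge0// => v _; exact: lam_ge0. Qed.

Lemma mean_cst a : mean (fun=> a) = a.
Proof.
rewrite /mean -mulr_suml /pmass -mulr_suml -/(Z eH lam eG).
by rewrite mulfV ?mul1r// gt_eqF ?Z_gt0.
Qed.

Lemma le_mean F G : (forall f, F f <= G f) -> mean F <= mean G.
Proof. by move=> FG; apply: ler_sum => f _; rewrite ler_wpM2l ?pmass_ge0. Qed.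

Lemma mean_affine F a b : mean (fun f => a + b * F f) = a + b * mean F.
Proof.
rewrite -[X in X + _](mean_cst a) mulr_sumr -big_split/=.
by apply: eq_bigr => f _; ring.
Qed.

Lemma prob_mean E : prob eH lam eG E = mean (fun f => (E f)%:R).
Proof.
rewrite /prob big_mkcondr/=; apply: eq_bigr => f _.
by case: (E f); rewrite ?mulr1 ?mulr0.
Qed.

Lemma occupationE k f : occupation k f = \sum_v (f v == k)%:R.
Proof.
rewrite /occupation -sum1_card natr_sum big_mkcond/=; apply: eq_bigr => v _.
by rewrite !inE; case: (f v == k).
Qed.

Lemma pbar_mean k : #|VG|%:R * pbar eH lam eG k = mean (occupation k).
Proof.
rewrite /pbar mulrA mulfV ?mul1r ?pnatr_eq0 -?lt0n//.
under eq_bigr do rewrite prob_mean.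
rewrite exchange_big/=; apply: eq_bigr => f _.
by rewrite occupationE mulr_sumr.
Qed.

Lemma wcol_tilt k t f :
  wcol (tilt lam k t) f = wcol lam f * expR (t * occupation k f).
Proof.
rewrite occupationE mulr_sumr expR_sum -big_split; exact: eq_bigr.
Qed.

(** The hypothesis on the optimal pairs says that [a] bounds their normalised
    slopes from above if [t] is positive, and from below if [t] is negative;
    this treats both tails at once. *)
Lemma mgf_occupation k (t a : R) :
  `|t| <= 1 / 2 -> 0 <= a <= 1 ->
  (forall AB, AB \in optimal_pairs eH lam ->
     t * kweight lam k AB <= t * (2 * Defs.eta eH lam * a)) ->
  mean (fun f => expR (t * occupation k f)) <=
  expR (#|VG|%:R *
        (a * t + curvature eH lam * t ^+ 2 + union_loss / d%:R)).
Proof.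
move=> ht ha opt; have [X bipX] := bipG.
have -> : mean (fun f => expR (t * occupation k f)) =
    Z eH (tilt lam k t) eG / Z eH lam eG.
  rewrite /mean {2}/Z mulr_suml; apply: eq_bigr => f _.
  by rewrite wcol_tilt /pmass mulrAC.
rewrite ler_pdivrMr ?Z_gt0//.
have tilt0 i : 0 <= tilt lam k t i by rewrite mulr_ge0 ?expR_ge0 ?lam_ge0.
have [i0 _] := edgeH.
have tiltW : 0 < \sum_i tilt lam k t i.
  rewrite (bigD1 i0)//=; apply: ltr_wpDr; first exact: sumr_ge0.
  by rewrite mulr_gt0 ?expR_gt0.
have e0 := eta_gt0 edgeH lam_gt0.
apply: le_trans (Z_le symH d_gt0 symG regG bipX tilt0 tiltW
  (fun A B AB => tilted_eta_le edgeH lam_gt0 ht ha AB opt)) _.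
have [AB ABo] := set0Pn _ (optimal_pairs_neq0 eH lam).
have [ABc ABe] := optimalP ABo.
have := Z_ge symH d_gt0 symG regG bipX lam_ge0 ABc; rewrite ABe => Zge.
apply: le_trans (ler_wpM2l (expR_ge0 _) Zge).
have d0 : d%:R != 0 :> R by rewrite pnatr_eq0 -lt0n.
have -> : (2 ^ #|VH|)%N%:R `^ d%:R^-1 = expR (#|VH|%:R * ln 2 / d%:R) :> R.
  by rewrite expRM mulrC expRM lnK ?posrE// powR_mulrn ?ler0n// natrX.
rewrite (card_double d_gt0 symG regG bipX) addnn -mul2n natrM.
rewrite mulrCA -expRD exprMn mulrC ler_wpM2r ?exprn_ge0 ?(ltW e0)//.
rewrite -expRM_natl ler_expR le_eqVlt; apply/orP; left; apply/eqP.
by rewrite /union_loss; field.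
Qed.

(** The exponential form of Markov's inequality. *)
Lemma tail_occupation k (t a eps : R) (E : pred {ffun VG -> VH}) :
  `|t| <= 1 / 2 -> 0 <= a <= 1 ->
  (forall AB, AB \in optimal_pairs eH lam ->
     t * kweight lam k AB <= t * (2 * Defs.eta eH lam * a)) ->
  (forall f, E f ->
     #|VG|%:R * (t * a + `|t| * eps) <= t * occupation k f) ->
  prob eH lam eG E <=
  expR (#|VG|%:R *
        (curvature eH lam * t ^+ 2 + union_loss / d%:R - `|t| * eps)).
Proof.
move=> ht ha opt Eocc; rewrite prob_mean.
set s := #|VG|%:R * (t * a + `|t| * eps).
apply: (@le_trans _ _ (mean (fun f => 0 + expR (- s) * expR (t * occupation k f)))).
  apply: le_mean => f; rewrite add0r -expRD.
  case: (boolP (E f)) => [/Eocc Ef|_]; last by rewrite expR_ge0.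
  by rewrite -expR0 ler_expR; rewrite -/s in Ef; lra.
rewrite mean_affine add0r.
apply: le_trans (ler_wpM2l (expR_ge0 _) (mgf_occupation ht ha opt)) _.
by rewrite -expRD ler_expR le_eqVlt; apply/orP; left; apply/eqP; rewrite /s; ring.
Qed.

(** Jensen's inequality for the exponential, through its tangent at [t * M]. *)
Lemma mean_occupation_le k (t a : R) :
  `|t| <= 1 / 2 -> 0 <= a <= 1 ->
  (forall AB, AB \in optimal_pairs eH lam ->
     t * kweight lam k AB <= t * (2 * Defs.eta eH lam * a)) ->
  t * pbar eH lam eG k <=
  a * t + curvature eH lam * t ^+ 2 + union_loss / d%:R.
Proof.
move=> ht ha opt; rewrite -(@ler_pM2l _ #|VG|%:R) ?ltr0n//.
rewrite mulrCA pbar_mean -ler_expR; apply: le_trans (mgf_occupation ht ha opt).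
set M := mean (occupation k).
apply: (@le_trans _ _ (mean (fun f =>
  expR (t * M) * (1 - t * M) + expR (t * M) * t * occupation k f))).
  by rewrite mean_affine -/M le_eqVlt; apply/orP; left; apply/eqP; ring.
apply: le_mean => f.
have -> : expR (t * occupation k f) = expR (t * M) * expR (t * (occupation k f - M)).
  by rewrite -expRD; congr expR; ring.
rewrite -mulrA -mulrDr ler_wpM2l ?expR_ge0//.
by apply: le_trans (expR_ge1Dx _); lra.
Qed.

Lemma opt_upper k t : 0 <= t -> forall AB, AB \in optimal_pairs eH lam ->
  t * kweight lam k AB <= t * (2 * Defs.eta eH lam * aplus eH lam k).
Proof. by move=> t0 AB ABo; rewrite ler_wpM2l// kweight_le_aplus. Qed.

Lemma opt_lower k t : t <= 0 -> forall AB, AB \in optimal_pairs eH lam ->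
  t * kweight lam k AB <= t * (2 * Defs.eta eH lam * aminus eH lam k).
Proof. by move=> t0 AB ABo; rewrite ler_wnM2l// aminus_le_kweight. Qed.

Lemma pbar_bounds k :
  aminus eH lam k - (curvature eH lam + 2 * union_loss) / Num.sqrt d%:R
    <= pbar eH lam eG k <=
  aplus eH lam k + (curvature eH lam + 2 * union_loss) / Num.sqrt d%:R.
Proof.
set r : R := Num.sqrt d%:R.
have r1 : 1 <= r by rewrite -sqrtr1 ler_sqrt ?ler0n// ler1n.
have r2 : d%:R = r ^+ 2 :> R by rewrite sqr_sqrtr ?ler0n.
have r0 : 0 < r by lra.
(* Up to a constant this balances [C * t] against [union_loss / (d * t)]. *)
pose t : R := 1 / (2 * r).
have t0 : 0 < t by rewrite divr_gt0 ?mulr_gt0.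
have th : `|t| <= 1 / 2.
  by rewrite gtr0_norm// ler_pdivrMr ?mulr_gt0//; lra.
have thN : `|- t| <= 1 / 2 by rewrite normrN.
have C1 := curvature_ge1 edgeH lam_gt0.
have cost : curvature eH lam * t ^+ 2 + union_loss / d%:R <=
    t * ((curvature eH lam + 2 * union_loss) / r).
  have -> : t * ((curvature eH lam + 2 * union_loss) / r) =
      curvature eH lam * t ^+ 2 + union_loss / d%:R + curvature eH lam * t ^+ 2.
    by rewrite /t r2; field; rewrite gt_eqF.
  by rewrite lerDl mulr_ge0 ?sqr_ge0//; lra.
have up := mean_occupation_le th (aplus_itv edgeH lam_gt0 k) (opt_upper k (ltW t0)).
have tN : - t <= 0 by lra.
have lo := mean_occupation_le thN (aminus_itv edgeH lam_gt0 k) (opt_lower k tN).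
rewrite sqrrN in lo; apply/andP; split; rewrite -(ler_pM2l t0); nra.
Qed.

Lemma prob_Ik k (eps : R) :
  0 < eps <= 1 ->
  union_loss / d%:R <= eps ^+ 2 / (8 * curvature eH lam) ->
  prob eH lam eG (fun f => Ik eH lam k eps (share R k f)) <=
  2 * expR (- (#|VG|%:R * (eps ^+ 2 / (8 * curvature eH lam)))).
Proof.
move=> /andP[eps0 eps1] small; set C := curvature eH lam.
have C1 : 1 <= C := curvature_ge1 edgeH lam_gt0.
have C0 : 0 < C by lra.
have N0 : 0 < #|VG|%:R :> R by rewrite ltr0n.
(* The minimiser of [C * t ^+ 2 - t * eps], with minimum [- eps ^+ 2 / (4 * C)];
   half of this is left for [union_loss / d]. *)
pose t := eps / (2 * C).
have t0 : 0 < t by rewrite divr_gt0 ?mulr_gt0.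
have th : `|t| <= 1 / 2.
  by rewrite gtr0_norm// ler_pdivrMr ?mulr_gt0//; lra.
have thN : `|- t| <= 1 / 2 by rewrite normrN.
have tN : - t <= 0 by lra.
have cost : C * t ^+ 2 + union_loss / d%:R - t * eps <= - (eps ^+ 2 / (8 * C)).
  have -> : C * t ^+ 2 + union_loss / d%:R - t * eps =
    union_loss / d%:R - 2 * (eps ^+ 2 / (8 * C)).
    by rewrite /t; field; rewrite gt_eqF// pnatr_eq0 -lt0n d_gt0.
  by rewrite -/C in small; lra.
have tail : expR (#|VG|%:R * (C * t ^+ 2 + union_loss / d%:R - t * eps)) <=
    expR (- (#|VG|%:R * (eps ^+ 2 / (8 * C)))).
  by rewrite ler_expR -[leRHS]mulrN ler_wpM2l// ltW.
pose El (f : {ffun VG -> VH}) := share R k f < aminus eH lam k - eps.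
pose Eu (f : {ffun VG -> VH}) := aplus eH lam k + eps < share R k f.
have pl : prob eH lam eG El <= expR (- (#|VG|%:R * (eps ^+ 2 / (8 * C)))).
  apply: le_trans tail; rewrite -[X in _ - X * _](gtr0_norm t0) -normrN -sqrrN.
  apply: (tail_occupation thN (aminus_itv edgeH lam_gt0 k) (opt_lower k tN)) => f.
  rewrite /El /share ltr_pdivrMr// -/(occupation k f) => Ef.
  by rewrite normrN gtr0_norm//; nra.
have pu : prob eH lam eG Eu <= expR (- (#|VG|%:R * (eps ^+ 2 / (8 * C)))).
  apply: le_trans tail; rewrite -[X in _ - X * _](gtr0_norm t0).
  apply: (tail_occupation th (aplus_itv edgeH lam_gt0 k) (opt_upper k (ltW t0))) => f.
  rewrite /Eu /share ltr_pdivlMr// -/(occupation k f) => Ef.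
  by rewrite gtr0_norm//; nra.
apply: (@le_trans _ _ (prob eH lam eG El + prob eH lam eG Eu)); last by lra.
rewrite !prob_mean /mean -big_split/=; apply: ler_sum => f _.
rewrite -mulrDr ler_wpM2l ?pmass_ge0// -natrD ler_nat.
rewrite /El /Eu /Ik/= !in_itv/=.
case: (share R k f < aminus eH lam k - eps) => /=; last first.
  by rewrite andbF; case: (_ < _); case: (_ <= _).
by case: (0 <= share R k f); case: (_ < _); case: (_ <= _).
Qed.

(** As [aminus] and [aplus] lie in the unit interval, [Ik] is then empty. *)
Lemma prob_Ik_gt1 k (eps : R) : 1 < eps ->
  prob eH lam eG (fun f => Ik eH lam k eps (share R k f)) = 0.
Proof.
move=> eps1; rewrite /prob big1// => f /andP[_]; rewrite /Ik/= !in_itv/=.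
have /andP[_ m1] := aminus_itv edgeH lam_gt0 k.
have /andP[p0 _] := aplus_itv edgeH lam_gt0 k.
by case/orP => /andP[h1 h2]; lra.
Qed.

End Occupation.

Theorem theorem1p2 (R : realType) (VH : finType) (eH : rel VH) (lam : VH -> R)
    (symH : symmetric eH) (edgeH : exists i j : VH, eH i j)
    (lam_gt0 : forall i : VH, 0 < lam i) :
  exists c1 c2 c3 c4 : R,
    [/\ 0 < c1, 0 < c2, 0 < c3 & 0 < c4] /\
    forall (d N : nat) (VG : finType) (eG : rel VG),
      (1 <= d)%N -> (1 <= N)%N -> #|VG| = N ->
      symmetric eG -> irreflexive eG -> regular eG d -> bipartite eG ->
      (forall (eps : R) (k : VH), c1 / Num.sqrt d%:R <= eps ->
         prob eH lam eG (fun f => Ik eH lam k eps (share R k f))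
           <= c2 * eps^-1 * 2 `^ (- (c3 * eps ^+ 2 * N%:R)))
      /\
      (forall k : VH,
         let zeta : R :=
           Num.max (1 / Num.sqrt d%:R) (Num.sqrt (log2 N%:R / N%:R)) in
         aminus eH lam k - c4 * zeta <= pbar eH lam eG k
           <= aplus eH lam k + c4 * zeta).
Proof.
pose C := curvature eH lam; pose L : R := union_loss R VH.
have C1 : 1 <= C := curvature_ge1 edgeH lam_gt0.
have ln2 : 0 < ln 2 :> R by rewrite ln_gt0// ltr1n.
have L0 : 0 <= L by rewrite divr_ge0// mulr_ge0// ltW.
exists (1 + 8 * C * L), 2, (1 / (8 * C * ln 2)), (C + 2 * L).
have CL0 : 0 <= C * L by rewrite mulr_ge0//; lra.
split.
  split; rewrite ?divr_gt0 ?mulr_gt0//; lra.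
move=> d N VG eG d0 N0 VGN symG _ regG bipG; subst N.
set r : R := Num.sqrt d%:R.
have r2 : d%:R = r ^+ 2 :> R by rewrite sqr_sqrtr ?ler0n.
have r0 : 0 < r by rewrite sqrtr_gt0 ltr0n.
split=> [eps k heps|k /=]; last first.
  set zeta := Num.max _ _.
  have /andP[lo up] := pbar_bounds symH edgeH lam_gt0 d0 N0 symG regG bipG k.
  have hz : (C + 2 * L) / r <= (C + 2 * L) * zeta.
    rewrite ler_wpM2l//; first by lra.
    by rewrite /zeta le_max div1r lexx.
  by rewrite -/C -/L -/r in lo up; apply/andP; split; lra.
have eps0 : 0 < eps by apply: lt_le_trans heps; rewrite divr_gt0//; lra.
have [eps1|eps1] := lerP eps 1; last first.
  rewrite (prob_Ik_gt1 edgeH)//.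
  by rewrite mulr_ge0 ?powR_ge0// mulr_ge0// invr_ge0 ltW.
(* By the choice of [c1], using [c1 <= c1 ^+ 2] *)
have small : L / d%:R <= eps ^+ 2 / (8 * C).
  rewrite ler_pdivrMr ?ltr0n// mulrAC ler_pdivlMr; last lra.
  move: heps; rewrite ler_pdivrMr// r2 -exprMn => heps.
  have := CL0; nra.
apply: le_trans (prob_Ik symH edgeH lam_gt0 d0 N0 symG regG bipG k _ small) _.
  by rewrite eps0.
rewrite -mulrA ler_wpM2l//.
have -> : 2 `^ (- (1 / (8 * C * ln 2) * eps ^+ 2 * #|VG|%:R)) =
    expR (- (#|VG|%:R * (eps ^+ 2 / (8 * C)))) :> R.
  rewrite /powR pnatr_eq0/=; congr expR; rewrite -/C.
  by field; rewrite !gt_eqF//; lra.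
by rewrite ler_peMl ?expR_ge0// invf_ge1.
Qed.
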